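(* Let $M$ be a 2-dimensional Riemannian manifold of Gaussian curvature $K$, and let $\xi$ be a smooth unit vector field on $M$. Let $e_0,e_1,\eta$ be smooth unit vector fields on $M$ such that $\nabla_{e_0}\xi=0$ and $(\xi,\eta)$, $(e_0,e_1)$ are orthonormal frames, and let $\lambda,\mu$ be the functions defined by $\nabla_{e_1}\xi=\lambda\eta$, $\nabla_{e_0}e_0=\mu e_1$. Put $s=1$ if the frames $(\xi,\eta)$ and $(e_0,e_1)$ have the same orientation and $s=0$ otherwise. Then the Gaussian curvature $K_\xi$ of the hypersurface $\xi(M)\subset T_1M$ is given by $$ K_\xi=\frac{K^2}{4}+\frac{K(1-K)}{1+\lambda^2}+(-1)^{s+1}\frac{\lambda}{1+\lambda^2}\,e_0(K)+\frac12\,\mu\, e_1\!\left(\frac{1}{1+\lambda^2}\right)-\left((-1)^{s+1}\frac{K}{2}+\frac{e_0(\lambda)}{1+\lambda^2}\right)^2 . $$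
   Context: For a Riemannian manifold $(M,g)$ with Levi-Civita connection $\nabla$, each tangent vector $\tilde X$ to $TM$ at $(p,\zeta)$ decomposes uniquely as $\tilde X=X_1^h+X_2^v$ with $X_1,X_2\in T_pM$, where $(\cdot)^h$ and $(\cdot)^v$ are the horizontal (with respect to $\nabla$) and vertical lifts. The Sasaki metric on $TM$ is $\langle\langle \tilde X,\tilde Y\rangle\rangle=\langle X_1,Y_1\rangle+\langle X_2,Y_2\rangle$. The unit tangent bundle $T_1M\subset TM$ carries the induced metric. A unit vector field $\xi$ is viewed as a map $\xi:M\to T_1M$, and $\xi(M)$ carries the metric induced from $T_1M$. $K_\xi$ at the point $\xi(p)$ is expressed through the values of functions at $p\in M$. $X(\phi)$ denotes the derivative of a function $\phi$ along a vector field $X$. *)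

(* Defs.v *)
From HB Require Import structures.
From mathcomp Require Import all_boot all_order all_algebra.
From mathcomp Require Import all_classical all_reals all_analysis.

Set Implicit Arguments.
Unset Strict Implicit.
Unset Printing Implicit Defensive.

Import Order.TTheory GRing.Theory Num.Theory.
Import numFieldNormedType.Exports.

Local Open Scope classical_set_scope.
Local Open Scope ring_scope.

(* C^oo on a set U (in practice open), for maps between finite-dimensional
   spaces: every iterated directional derivative is differentiable on U. *)
Definition smooth_on (R : realType) (V W : normedModType R)
    (U : set V) (f : V -> W) : Prop :=
  forall (vs : seq V) (x : V), U x ->
    differentiable (foldr (fun v h => fun y => 'D_v h y) f vs) x.

(* A chart is a partial bijection between M and the model space V: cmap is
   meaningful on cdom, cinv on the image cimg. *)
Record chart (R : realType) (V : normedModType R) (M : Type) := Chart {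
  cdom : set M;
  cmap : M -> V;
  cinv : V -> M }.

Definition cimg (R : realType) (V : normedModType R) (M : Type)
    (c : chart V M) : set V := cmap c @` cdom c.

(* An atlas together with a preferred chart around each point. The preferred
   chart is used to represent tangent vectors: T_pM is the model space V, a
   vector being given by its components in the chart chart_at p. *)
Record charted (R : realType) (V : normedModType R) (M : Type) := Charted {
  atlas : set (chart V M);
  chart_at : M -> chart V M }.

Definition smooth_manifold (R : realType) (V : normedModType R)
    (M : topologicalType) (A : charted V M) : Prop :=
  [/\ hausdorff_space M,
      @second_countable M,
      forall p, atlas A (chart_at A p) /\ cdom (chart_at A p) p,
      forall c, atlas A c ->
        [/\ open (cdom c), open (cimg c),
            forall p, cdom c p -> cinv c (cmap c p) = p,
            {within cdom c, continuous (cmap c)} &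
            {within cimg c, continuous (cinv c)}] &
      forall c d, atlas A c -> atlas A d ->
        smooth_on (cmap c @` (cdom c `&` cdom d)) (cmap d \o cinv c)].

Section Calculus.
Context {R : realType} {V : normedModType R} {M : Type}.
Variable A : charted V M.

Definition smooth_fun (f : M -> R) : Prop :=
  forall c, atlas A c -> smooth_on (cimg c) (f \o cinv c : V -> R^o).

(* X(f) *)
Definition dfun (X : M -> V) (f : M -> R) (p : M) : R :=
  'D_(X p) (f \o cinv (chart_at A p) : V -> R^o) (cmap (chart_at A p) p).

(* Components in the chart c of the tangent vector v at p. *)
Definition vec_in (c : chart V M) (p : M) (v : V) : V :=
  'D_v (cmap c \o cinv (chart_at A p)) (cmap (chart_at A p) p).

Definition field_in (c : chart V M) (X : M -> V) (x : V) : V :=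
  vec_in c (cinv c x) (X (cinv c x)).

Definition smooth_field (X : M -> V) : Prop :=
  forall c, atlas A c -> smooth_on (cimg c) (field_in c X).

(* The derivative at p, in the direction X p, of the components of Y in the
   preferred chart at p. *)
Definition dfield (X Y : M -> V) (p : M) : V :=
  'D_(X p) (field_in (chart_at A p) Y) (cmap (chart_at A p) p).

Definition bracket (X Y : M -> V) (p : M) : V :=
  dfield X Y p - dfield Y X p.

Definition inner (g : M -> V -> V -> R) (X Y : M -> V) (p : M) : R :=
  g p (X p) (Y p).

Definition riemannian_metric (g : M -> V -> V -> R) : Prop :=
  [/\ forall p u v, g p u v = g p v u,
      forall p a u v w, g p (a *: u + v) w = a * g p u w + g p v w,
      forall p u, u != 0 -> 0 < g p u u &
      forall X Y, smooth_field X -> smooth_field Y ->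
        smooth_fun (inner g X Y)].

(* An affine connection is represented by its Christoffel symbols: Gamma p u v
   is \sum_ij Gamma^k_ij(p) u^i v^j in the preferred chart at p. *)
Definition nabla (Gamma : M -> V -> V -> V) (X Y : M -> V) (p : M) : V :=
  dfield X Y p + Gamma p (X p) (Y p).

Definition affine_connection (Gamma : M -> V -> V -> V) : Prop :=
  [/\ forall p a u v w,
        Gamma p (a *: u + v) w = a *: Gamma p u w + Gamma p v w,
      forall p a u v w,
        Gamma p w (a *: u + v) = a *: Gamma p w u + Gamma p w v &
      forall X Y, smooth_field X -> smooth_field Y ->
        smooth_field (nabla Gamma X Y)].

Definition levi_civita (g : M -> V -> V -> R) (Gamma : M -> V -> V -> V) :
    Prop :=
  [/\ affine_connection Gamma,
      forall X Y, smooth_field X -> smooth_field Y -> forall p,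
        nabla Gamma X Y p - nabla Gamma Y X p = bracket X Y p &
      forall X Y Z, smooth_field X -> smooth_field Y -> smooth_field Z ->
        forall p, dfun X (inner g Y Z) p =
          inner g (nabla Gamma X Y) Z p + inner g Y (nabla Gamma X Z) p].

Definition riemann (Gamma : M -> V -> V -> V) (X Y Z : M -> V) (p : M) : V :=
  nabla Gamma X (nabla Gamma Y Z) p - nabla Gamma Y (nabla Gamma X Z) p
  - nabla Gamma (bracket X Y) Z p.

(* K is the Gaussian (sectional) curvature of the surface (M, g); meant for a
   2-dimensional V, where both sides are multiples of the same form. *)
Definition gaussian_curvature (g : M -> V -> V -> R) (K : M -> R) : Prop :=
  exists2 Gamma, levi_civita g Gamma &
    forall X Y, smooth_field X -> smooth_field Y -> forall p,
      inner g (riemann Gamma X Y Y) X p =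
        K p * (inner g X X p * inner g Y Y p - inner g X Y p ^+ 2).

(* The chart (p, v) |-> (cmap c p, components of v in c) of TM; the inverse
   rewrites components in c as components in the preferred chart. *)
Definition tangent_chart (c : chart V M) : chart (V * V)%type (M * V)%type :=
  Chart [set z : M * V | cdom c z.1]
    (fun z => (cmap c z.1, vec_in c z.1 z.2))
    (fun y => (cinv c y.1,
       'D_(y.2) (cmap (chart_at A (cinv c y.1)) \o cinv c) y.1)).

(* TM, with carrier M * V. Its tangent space at z = (p, zeta) is V * V, by
   components in the chart induced by the preferred chart at p. *)
Definition tangent_bundle : charted (V * V)%type (M * V)%type :=
  Charted [set tangent_chart c | c in atlas A]
    (fun z => tangent_chart (chart_at A z.1)).

Definition section_of (X : M -> V) (p : M) : M * V := (p, X p).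

Definition unit_tangent_bundle (g : M -> V -> V -> R) : set (M * V) :=
  [set z | g z.1 z.2 z.2 = 1].

Definition unit_section (g : M -> V -> V -> R) (X : M -> V)
    (hX : forall p, inner g X X p = 1) (p : M) : unit_tangent_bundle g :=
  exist _ (section_of X p) (mem_set (hX p)).

(* (u, w) is the velocity at 0 of a curve t |-> (c t, Z t) with c' = u,
   Z' = w; it is horizontal when Z' + Gamma (c', Z) = 0. *)
Definition hlift (Gamma : M -> V -> V -> V) (z : M * V) (u : V) : V * V :=
  (u, - Gamma z.1 u z.2).

Definition vlift (u : V) : V * V := (0, u).

Definition hpart (w : V * V) : V := w.1.

Definition vpart (Gamma : M -> V -> V -> V) (z : M * V) (w : V * V) : V :=
  w.2 + Gamma z.1 w.1 z.2.

Lemma hv_decomposition (Gamma : M -> V -> V -> V) (z : M * V)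
    (w : V * V) (u1 u2 : V) :
  w = hlift Gamma z u1 + vlift u2 <-> u1 = hpart w /\ u2 = vpart Gamma z w.
Proof.
rewrite /hpart /vpart /hlift /vlift; case: w => w1 w2 /=; split.
  by case=> -> ->; rewrite addr0 addrAC addNr add0r.
case=> -> ->; congr pair; first by rewrite /= addr0.
by rewrite /= addrCA addNr addr0.
Qed.

Definition sasaki (g : M -> V -> V -> R) (Gamma : M -> V -> V -> V)
    (z : M * V) (w w' : V * V) : R :=
  g z.1 (hpart w) (hpart w') + g z.1 (vpart Gamma z w) (vpart Gamma z w').

End Calculus.

Section Immersion.
Context {R : realType} {V W : normedModType R} {M N : Type}.
Variables (A : charted V M) (B : charted W N).

Definition differential (F : M -> N) (p : M) (v : V) : W :=
  'D_v (cmap (chart_at B (F p)) \o F \o cinv (chart_at A p))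
       (cmap (chart_at A p) p).

Definition induced_metric (F : M -> N) (G : N -> W -> W -> R)
    (p : M) (u v : V) : R :=
  G (F p) (differential F p u) (differential F p v).

(* For an embedding F of a surface M into a submanifold S of (N, G): k is, at
   the points of F(M), the Gaussian curvature of F(M) with the metric induced
   from S. Vectors tangent to S are seen as vectors tangent to N, and the metric
   of S is the restriction of G, so the induced metric is computed in N. *)
Definition image_gaussian_curvature (S : set N) (F : M -> S)
    (G : N -> W -> W -> R) (k : S -> R) : Prop :=
  gaussian_curvature A (induced_metric (fun p => val (F p)) G) (k \o F).

End Immersion.

Section Frames.
Context {R : realType} {M : Type}.

Definition orthonormal_frame (g : M -> 'rV[R]_2 -> 'rV[R]_2 -> R)
    (X Y : M -> 'rV[R]_2) : Prop :=
  forall p, [/\ inner g X X p = 1, inner g Y Y p = 1 & inner g X Y p = 0].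

Definition same_orientation (X Y X' Y' : M -> 'rV[R]_2) (p : M) : bool :=
  0 < \det (col_mx (X p) (Y p) : 'M[R]_2) *
      \det (col_mx (X' p) (Y' p) : 'M[R]_2).

End Frames.

(* Main.v *)
Require Import Defs.
From HB Require Import structures.
From mathcomp Require Import all_boot all_order all_algebra.
From mathcomp Require Import all_classical all_reals all_analysis.
From mathcomp Require Import ring lra.

Set Implicit Arguments.
Unset Strict Implicit.
Unset Printing Implicit Defensive.

Import Order.TTheory GRing.Theory Num.Theory.
Import numFieldNormedType.Exports.

Local Open Scope classical_set_scope.
Local Open Scope ring_scope.

(** Put [F = 1 + lambda^2]. The metric [h] that the section [xi] induces on the
surface is [h(X,Y) = g(X,Y) + g(nabla_X xi, nabla_Y xi)]
([sasaki_induced_metric]). As [nabla_{e0} xi = 0] and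
[nabla_{e1} xi = lambda eta], the fields [e0, e1] stay orthogonal for [h], with
[h(e0,e0) = 1] and [h(e1,e1) = F]. So the theorem compares the curvatures of
two metrics, [g] and [h], which share an orthogonal frame.

The tool is the structure equation [frame_curvature]: for any metric [h] with an
orthogonal frame whose first field is unit, [h(R(E0,E1)E1,E0)] is a first-order
expression in [F = h(E1,E1)] and the connection coefficients
[a = h(nabla_{E0}E0, E1)] and [c = h(nabla_{E1}E0, E1)]; and [a], [c] are
determined by the bracket [[E0,E1]] and by [F] ([koszul_E0], [koszul_E1]).
It is used three times.

- For [g] and [(e0,e1)], with [sigma = g(nabla_{e1}e0, e1)], it gives
  [K = e1(mu) - e0(sigma) - mu^2 - sigma^2].
- For [g] and [(xi,eta)] it gives [K = - t (e0(lambda) + sigma lambda)], where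
  [t = 1] or [-1] is the determinant of the transition between the two frames
  ([curvature_rotation]). This expresses that the curvature measures the
  holonomy of [xi].
- For [h] and [(e0,e1)] the coefficients are [a = mu] and
  [c = lambda e0(lambda) + sigma F], and the second identity turns [c] into
  [sigma - t lambda K]. The second derivative of [lambda] is thus gone, and
  eliminating [e0(sigma)] and [sigma lambda] by the first two identities
  leaves the formula ([curvature_section_metric]), up to the factor
  [h(e0,e0) h(e1,e1) = F] that relates it to the Gaussian curvature.

The sign [t] is locally constant because its derivative vanishes
([dfun_transition_det]), and it is the [(-1)^(s+1)] of the statement
([transition_det_sign]). The curvature of [g] may be computed with the given
connection because the Levi-Civita connection is unique ([riemann_unique]).
Only inner products of fields are ever differentiated. Since the connection
preserves smooth fields, all of them are differentiable, and so is [K], by the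
second identity. *)

(** * Differentiation in the preferred charts *)

Section Charts.
Context {R : realType} {V : normedModType R} {M : topologicalType}.
Variable A : charted V M.
Hypothesis hA : smooth_manifold A.

Lemma atlas_chart_at p : atlas A (chart_at A p).
Proof. by case: hA => _ _ /(_ p)[]. Qed.

Lemma cdom_chart_at p : cdom (chart_at A p) p.
Proof. by case: hA => _ _ /(_ p)[]. Qed.

Lemma chart_atK p : cinv (chart_at A p) (cmap (chart_at A p) p) = p.
Proof.
case: hA => _ _ _ /(_ _ (atlas_chart_at p))[_ _ h _ _] _.
exact/h/cdom_chart_at.
Qed.

Lemma cimg_chart_at p : cimg (chart_at A p) (cmap (chart_at A p) p).
Proof. by exists p => //; exact: cdom_chart_at. Qed.

Lemma cinv_chart_atK_near p :
  \forall x \near cmap (chart_at A p) p,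
    cmap (chart_at A p) (cinv (chart_at A p) x) = x.
Proof.
case: hA => _ _ _ /(_ _ (atlas_chart_at p))[_ ho hK _ _] _.
have := open_nbhs_nbhs (conj ho (cimg_chart_at p)).
by apply: filterS => x [q dq <-]; rewrite hK.
Qed.

(** At each point only the preferred chart is tested, since [dfun]
differentiates in that chart. *)
Definition diff_fun (f : M -> R) : Prop := forall p,
  differentiable (f \o cinv (chart_at A p) : V -> R^o) (cmap (chart_at A p) p).

Lemma smooth_fun_diff f : smooth_fun A f -> diff_fun f.
Proof.
by move=> sf p; apply: (sf _ (atlas_chart_at p) [::]); exact: cimg_chart_at.
Qed.

Lemma diff_funD f g : diff_fun f -> diff_fun g ->
  diff_fun (fun q => f q + g q).
Proof. by move=> df dg p; exact: differentiableD (df p) (dg p). Qed.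

Lemma diff_funM f g : diff_fun f -> diff_fun g ->
  diff_fun (fun q => f q * g q).
Proof. by move=> df dg p; exact: differentiableM (df p) (dg p). Qed.

Lemma diff_funN f : diff_fun f -> diff_fun (fun q => - f q).
Proof. by move=> df p; exact: differentiableN (df p). Qed.

Lemma diff_fun_cst (a : R) : diff_fun (fun=> a).
Proof. by move=> p; exact: differentiable_cst. Qed.

Lemma dfun_cst X (a : R) p : dfun A X (fun=> a) p = 0.
Proof. exact: derive_cst. Qed.

Lemma dfunD X f g p : diff_fun f -> diff_fun g ->
  dfun A X (fun q => f q + g q) p = dfun A X f p + dfun A X g p.
Proof.
move=> df dg.
exact: deriveD (diff_derivable (df p)) (diff_derivable (dg p)).
Qed.

Lemma dfunN X f p : diff_fun f ->
  dfun A X (fun q => - f q) p = - dfun A X f p.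
Proof. move=> df; exact: deriveN (diff_derivable (df p)). Qed.

Lemma dfunM X f g p : diff_fun f -> diff_fun g ->
  dfun A X (fun q => f q * g q) p = f p * dfun A X g p + g p * dfun A X f p.
Proof.
move=> df dg; rewrite /dfun.
have := deriveM (diff_derivable (v := X p) (df p))
  (diff_derivable (v := X p) (dg p)).
by rewrite /= !chart_atK => <-.
Qed.

Lemma dfunV X f p : diff_fun f -> f p != 0 ->
  dfun A X (fun q => (f q)^-1) p = - dfun A X f p / f p ^+ 2.
Proof.
move=> df f0; rewrite /dfun.
have f0' : (f \o cinv (chart_at A p)) (cmap (chart_at A p) p) != 0.
  by rewrite /= chart_atK.
have := deriveV f0' (diff_derivable (v := X p) (df p)).
rewrite /= chart_atK => ->.
by rewrite /GRing.scale /= mulNr mulNr mulrC.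
Qed.

Lemma dfun_comb X U W f p (a b : R) : diff_fun f ->
  X p = a *: U p + b *: W p ->
  dfun A X f p = a * dfun A U f p + b * dfun A W f p.
Proof.
by move=> df XE; rewrite /dfun XE !deriveE// linearD !linearZ.
Qed.

Lemma field_in_diff Y p : smooth_field A Y ->
  differentiable (field_in A (chart_at A p) Y) (cmap (chart_at A p) p).
Proof.
by move=> sY; apply: (sY _ (atlas_chart_at p) [::]); exact: cimg_chart_at.
Qed.

Lemma dfield_comb X U W Y p (a b : R) : smooth_field A Y ->
  X p = a *: U p + b *: W p ->
  dfield A X Y p = a *: dfield A U Y p + b *: dfield A W Y p.
Proof.
move=> sY XE; rewrite /dfield XE !deriveE ?linearD ?linearZ//;
 exact: field_in_diff.
Qed.

(** Tensoriality of a connection in its first argument. *)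
Lemma nabla_comb Gamma X U W Y p (a b : R) :
  affine_connection A Gamma -> smooth_field A Y ->
  X p = a *: U p + b *: W p ->
  nabla A Gamma X Y p = a *: nabla A Gamma U Y p + b *: nabla A Gamma W Y p.
Proof.
move=> [GL _ _] sY XE; rewrite /nabla (dfield_comb sY XE) XE.
have G0 w : Gamma p 0 w = 0.
  by have := GL p 1 0 0 w; rewrite scaler0 add0r scale1r => /eqP;
     rewrite -subr_eq0 opprD addNKr oppr_eq0 => /eqP.
rewrite GL -[b *: W p]addr0 GL G0 addr0 !scalerDr.
by rewrite addrACA.
Qed.

End Charts.

(** * Bilinear forms on the plane *)

Section Forms.
Context {R : realType}.

Section Bilinear.
Context {V : lmodType R}.
Variable b : V -> V -> R.
Hypothesis b_linl : forall a u v w, b (a *: u + v) w = a * b u w + b v w.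

Lemma metric0l w : b 0 w = 0.
Proof. by have := b_linl 1 0 0 w; rewrite scaler0 addr0; lra. Qed.

Lemma metricZl a u w : b (a *: u) w = a * b u w.
Proof. by rewrite -[a *: u]addr0 b_linl metric0l addr0. Qed.

Lemma metricDl u v w : b (u + v) w = b u w + b v w.
Proof. by rewrite -{1}[u]scale1r b_linl mul1r. Qed.

Lemma metricBl u v w : b (u - v) w = b u w - b v w.
Proof. by rewrite metricDl -scaleN1r metricZl mulN1r. Qed.

End Bilinear.

Lemma orthogonal_row_free (b : 'rV[R]_2 -> 'rV[R]_2 -> R) (u w : 'rV[R]_2) F :
  (forall u v, b u v = b v u) ->
  (forall a u v w, b (a *: u + v) w = a * b u w + b v w) ->
  b u u = 1 -> b w w = F -> b u w = 0 -> F != 0 ->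
  row_free (col_mx u w : 'M[R]_(1 + 1, 2)).
Proof.
move=> bC bL uu ww uw F0; apply/inj_row_free => x.
rewrite -[x]hsubmxK mul_row_col [lsubmx x]mx11_scalar [rsubmx x]mx11_scalar.
rewrite !mul_scalar_mx; move: (lsubmx x 0 0) (rsubmx x 0 0) => y z yz0.
have y0 : y = 0.
  have : b (y *: u + z *: w) u = 0 by rewrite yz0 metric0l.
  by rewrite (metricDl bL) !(metricZl bL) uu (bC w) uw mulr1 mulr0 addr0.
have z0 : z = 0.
  have : b (y *: u + z *: w) w = 0 by rewrite yz0 metric0l.
  rewrite (metricDl bL) !(metricZl bL) uw ww mulr0 add0r => /eqP.
  by rewrite mulf_eq0 (negPf F0) orbF => /eqP.
by rewrite y0 z0 !raddf0 row_mx0.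
Qed.

(** Nondegeneracy on the pair [u, w] replaces positivity: it makes them linearly
independent, hence a basis of the plane. *)
Lemma orthogonal_expansion (b : 'rV[R]_2 -> 'rV[R]_2 -> R) (u w : 'rV[R]_2) F :
  (forall u v, b u v = b v u) ->
  (forall a u v w, b (a *: u + v) w = a * b u w + b v w) ->
  b u u = 1 -> b w w = F -> b u w = 0 -> F != 0 ->
  forall v, v = b v u *: u + (b v w / F) *: w.
Proof.
move=> bC bL uu ww uw F0 v.
have Bfree := orthogonal_row_free bC bL uu ww uw F0.
have Bfull : row_full (col_mx u w : 'M[R]_(1 + 1, 2)).
  by rewrite /row_full; move: Bfree; rewrite /row_free.
have /submxP[x] := submx_full v Bfull.
rewrite -[x]hsubmxK mul_row_col [lsubmx x]mx11_scalar [rsubmx x]mx11_scalar.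
rewrite !mul_scalar_mx; move: (lsubmx x 0 0) (rsubmx x 0 0) => y z vE.
have -> : b v u = y.
  by rewrite vE (metricDl bL) !(metricZl bL) uu [b w u]bC uw mulr1 mulr0 addr0.
have -> : b v w = z * F.
  by rewrite vE (metricDl bL) !(metricZl bL) uw ww mulr0 add0r.
by rewrite mulfK.
Qed.

Lemma orthogonal_parseval (b : 'rV[R]_2 -> 'rV[R]_2 -> R) (u w : 'rV[R]_2) F :
  (forall u v, b u v = b v u) ->
  (forall a u v w, b (a *: u + v) w = a * b u w + b v w) ->
  b u u = 1 -> b w w = F -> b u w = 0 -> F != 0 ->
  forall v v', b v v' = b v u * b v' u + b v w * b v' w / F.
Proof.
move=> bC bL uu ww uw F0 v v'.
rewrite {1}(orthogonal_expansion bC bL uu ww uw F0 v) (metricDl bL).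
rewrite !(metricZl bL).
by rewrite (bC u) (bC w) mulrAC.
Qed.

Lemma det_mx2 (C : 'M[R]_2) : \det C = C 0 0 * C 1 1 - C 0 1 * C 1 0.
Proof.
rewrite (expand_det_row _ 0) !big_ord_recl big_ord0 addr0 /cofactor !det_mx11.
rewrite !mxE /= expr0 expr1 mul1r mulN1r mulrN.
by congr (C _ _ * C _ _ - C _ _ * C _ _); exact/val_inj.
Qed.

Lemma det_col_mx (u w : 'rV[R]_2) :
  \det (col_mx u w : 'M[R]_2) = u 0 0 * w 0 1 - u 0 1 * w 0 0.
Proof.
have r0 j : (col_mx u w : 'M[R]_2) 0 j = u 0 j.
  by rewrite -(col_mxEu u w); congr (col_mx u w _ _); exact/val_inj.
have r1 j : (col_mx u w : 'M[R]_2) 1 j = w 0 j.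
  by rewrite -(col_mxEd u w); congr (col_mx u w _ _); exact/val_inj.
by rewrite det_mx2 !r0 !r1.
Qed.

(** The square of the determinant of a 2x2 matrix is its Gram determinant. *)
Lemma orthonormal_det_sqr (c d c' d' : R) :
  c ^+ 2 + d ^+ 2 = 1 -> c' ^+ 2 + d' ^+ 2 = 1 -> c * c' + d * d' = 0 ->
  (c * d' - d * c') ^+ 2 = 1.
Proof.
move=> h1 h2 h3.
have -> : (c * d' - d * c') ^+ 2 =
    (c ^+ 2 + d ^+ 2) * (c' ^+ 2 + d' ^+ 2) - (c * c' + d * d') ^+ 2.
  by ring.
by rewrite h1 h2 h3; ring.
Qed.

End Forms.

(** * Levi-Civita connections in orthogonal frames *)

Section Metric.
Context {R : realType} {M : topologicalType}.
Variable A : charted 'rV[R]_2 M.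
Hypothesis hA : smooth_manifold A.

(** The regularity of a metric that the curvature computations consume. It is
weaker than that of a Riemannian metric, so that the metric induced by a section
has it at once, being a sum of inner products of smooth fields. *)
Definition diff_metric (h : M -> 'rV[R]_2 -> 'rV[R]_2 -> R) : Prop :=
  [/\ forall p u v, h p u v = h p v u,
      forall p a u v w, h p (a *: u + v) w = a * h p u w + h p v w &
      forall X Y, smooth_field A X -> smooth_field A Y ->
        diff_fun A (inner h X Y)].

Lemma riemannian_diff_metric g : riemannian_metric A g -> diff_metric g.
Proof.
case=> gC gL _ sm; split=> // X Y sX sY.
exact: smooth_fun_diff (sm _ _ sX sY).
Qed.

Section LeviCivita.
Variables (h : M -> 'rV[R]_2 -> 'rV[R]_2 -> R)
  (Gamma : M -> 'rV[R]_2 -> 'rV[R]_2 -> 'rV[R]_2).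
Hypothesis hm : diff_metric h.
Hypothesis hG : levi_civita A h Gamma.
Local Notation N := (nabla A Gamma).

Lemma smooth_nabla X Y : smooth_field A X -> smooth_field A Y ->
  smooth_field A (N X Y).
Proof. by case: hG => -[_ _ +] _ _; apply. Qed.

Lemma innerC X Y : inner h X Y = inner h Y X.
Proof. by apply/funext => p; case: hm => + _ _; apply. Qed.

Variables E0 E1 : M -> 'rV[R]_2.
Hypotheses (s0 : smooth_field A E0) (s1 : smooth_field A E1).
Hypothesis h00 : forall p, inner h E0 E0 p = 1.
Hypothesis h01 : forall p, inner h E0 E1 p = 0.

Let compat X Y Z p : smooth_field A X -> smooth_field A Y ->
    smooth_field A Z ->
  dfun A X (inner h Y Z) p = inner h (N X Y) Z p + inner h Y (N X Z) p.
Proof. by case: hG => _ _ + sX sY sZ; apply. Qed.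

Lemma nabla_unit X p : smooth_field A X -> inner h (N X E0) E0 p = 0.
Proof.
move=> sX; have := compat p sX s0 s0.
rewrite [inner h E0 E0](_ : _ = fun=> 1); last exact/funext.
rewrite dfun_cst [inner h E0 _]innerC; lra.
Qed.

Lemma nabla_orthogonal X p : smooth_field A X ->
  inner h (N X E1) E0 p = - inner h (N X E0) E1 p.
Proof.
move=> sX; have := compat p sX s0 s1.
rewrite [inner h E0 E1](_ : _ = fun=> 0); last exact/funext.
rewrite dfun_cst [inner h E0 _]innerC; lra.
Qed.

Lemma nabla_norm X p : smooth_field A X ->
  inner h (N X E1) E1 p = dfun A X (inner h E1 E1) p / 2.
Proof.
move=> sX; rewrite (compat p sX s1 s1) [inner h E1 (N _ _)]innerC; lra.
Qed.

Lemma inner_bracket X Y Z p : smooth_field A X -> smooth_field A Y ->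
  inner h (bracket A X Y) Z p = inner h (N X Y) Z p - inner h (N Y X) Z p.
Proof.
case: hG => _ tors _ sX sY; case: hm => hC hL _.
by rewrite /inner -tors// (metricBl (hL p)).
Qed.

(** Torsion-freeness and compatibility, in the spirit of Koszul's formula: in an
orthogonal frame the connection coefficients can be read off the bracket of the
frame and the norms. This is how the connections of two metrics sharing a frame
are compared. *)
Lemma koszul_E0 p :
  inner h (N E0 E0) E1 p = - inner h (bracket A E0 E1) E0 p.
Proof.
by rewrite inner_bracket// nabla_orthogonal// nabla_unit// subr0 opprK.
Qed.

Lemma koszul_E1 p : inner h (N E1 E0) E1 p =
  dfun A E0 (inner h E1 E1) p / 2 - inner h (bracket A E0 E1) E1 p.
Proof. by rewrite inner_bracket// nabla_norm//; lra. Qed.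

(** The structure equation of an orthogonal frame with unit first field. Each
second covariant derivative is reduced to inner products by compatibility:
[h(nabla_Y W, E0) = Y(h(W,E0)) - h(W, nabla_Y E0)] with [W = nabla_X E1], and
the last term is expanded in the frame. The curvature thus appears without
commuting two derivatives of a function. *)
Lemma frame_curvature p :
  let a := inner h (N E0 E0) E1 in
  let c := inner h (N E1 E0) E1 in
  let F := inner h E1 E1 in
  F p != 0 ->
  inner h (riemann A Gamma E0 E1 E1) E0 p =
    dfun A E1 a p - dfun A E0 c p - a p ^+ 2 - c p ^+ 2 / F p
    + c p * dfun A E0 F p / F p - a p * dfun A E1 F p / (2 * F p).
Proof.
move=> a c F F0; case: (hm) => hC hL hd.
have dN X Y Z : smooth_field A X -> smooth_field A Y -> smooth_field A Z ->
    diff_fun A (inner h (N X Y) Z).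
  by move=> sX sY sZ; exact: hd (smooth_nabla sX sY) sZ.
have da : diff_fun A a := dN _ _ _ s0 s0 s1.
have dc : diff_fun A c := dN _ _ _ s1 s0 s1.
have sN := smooth_nabla.
have parseval X Y : inner h X Y p =
    inner h X E0 p * inner h Y E0 p + inner h X E1 p * inner h Y E1 p / F p.
  exact: (orthogonal_parseval (hC p) (hL p) (h00 p) erefl (h01 p) F0).
have expand := orthogonal_expansion (hC p) (hL p) (h00 p) erefl (h01 p) F0.
have second X : smooth_field A X -> forall Y, smooth_field A Y ->
    inner h (N Y (N X E1)) E0 p =
    dfun A Y (inner h (N X E1) E0) p
      - inner h (N X E1) E1 p * inner h (N Y E0) E1 p / F p.
  move=> sX Y sY; rewrite (compat _ sY (sN _ _ sX s1) s0).
  by rewrite [inner h _ (N Y E0) p]parseval (nabla_unit p sY) mulr0 add0r addrK.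
have c1 X : smooth_field A X ->
    inner h (N X E1) E0 = fun q => - inner h (N X E0) E1 q.
  by move=> sX; apply/funext => q; rewrite nabla_orthogonal.
have brE : bracket A E0 E1 p = (- a p) *: E0 p +
     ((dfun A E0 F p / 2 - c p) / F p) *: E1 p.
  rewrite {1}(expand (bracket A E0 E1 p)).
  rewrite -/(inner h (bracket A E0 E1) E0 p) -/(inner h (bracket A E0 E1) E1 p).
  by rewrite /a koszul_E0 opprK /c koszul_E1 opprB addrCA subrr addr0.
have -> : inner h (riemann A Gamma E0 E1 E1) E0 p =
    inner h (N E0 (N E1 E1)) E0 p - inner h (N E1 (N E0 E1)) E0 p
    - inner h (N (bracket A E0 E1) E1) E0 p.
  by rewrite /inner /riemann !(metricBl (hL p)).
have -> : inner h (N (bracket A E0 E1) E1) E0 p =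
    (- a p) * (- a p) + (dfun A E0 F p / 2 - c p) / F p * (- c p).
  have [aff _ _] := hG.
  rewrite /inner (nabla_comb hA aff s1 brE) (metricDl (hL p)).
  rewrite !(metricZl (hL p)).
  congr (_ * _ + _ * _).
    exact: (nabla_orthogonal p s0).
  exact: (nabla_orthogonal p s1).
rewrite (second E1 s1 E0 s0) (second E0 s0 E1 s1) (nabla_norm p s0).
rewrite (nabla_norm p s1) (c1 _ s0) (c1 _ s1) !dfunN//.
rewrite -/a -/c -/F; move: F0.
move: (a p) (c p) (F p) (dfun A E1 a p) (dfun A E0 c p).
move: (dfun A E0 F p) (dfun A E1 F p).
by move=> f0 f1 x y f x1 y0 fn0; field.
Qed.

End LeviCivita.

(** The difference [D X Y Z] of the two candidates for [h(nabla_X Y, Z)] is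
symmetric in its first two arguments by torsion-freeness and skew in its last
two by compatibility. Such a trilinear expression vanishes: alternating the two
symmetries three times returns [D X Y Z] to itself with the opposite sign. *)
Lemma levi_civita_unique h Gamma Gamma' E0 E1 X Y :
  diff_metric h -> levi_civita A h Gamma -> levi_civita A h Gamma' ->
  smooth_field A E0 -> smooth_field A E1 -> orthonormal_frame h E0 E1 ->
  smooth_field A X -> smooth_field A Y ->
  nabla A Gamma X Y = nabla A Gamma' X Y.
Proof.
move=> hm [_ t m] [_ t' m'] s0 s1 fr sX sY; case: (hm) => hC hL _.
have key Z p : smooth_field A Z ->
    inner h (nabla A Gamma X Y) Z p = inner h (nabla A Gamma' X Y) Z p.
  move=> sZ.
  (* D12 and D23 are the two symmetries; lra chains six instances of them. *)
  pose D U W T :=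
    inner h (nabla A Gamma U W) T p - inner h (nabla A Gamma' U W) T p.
  have D12 U W T : smooth_field A U -> smooth_field A W -> D U W T = D W U T.
    move=> sU sW; rewrite /D /inner.
    have := congr1 (fun v => h p v (T p))
      (etrans (t _ _ sU sW p) (esym (t' _ _ sU sW p))).
    rewrite !(metricBl (hL p)); lra.
  have D23 U W T : smooth_field A U -> smooth_field A W -> smooth_field A T ->
      D U W T = - D U T W.
    move=> sU sW sT; rewrite /D.
    have := etrans (esym (m _ _ _ sU sW sT p)) (m' _ _ _ sU sW sT p).
    rewrite !(innerC hm W); lra.
  have : D X Y Z = 0.
    have := D12 X Y Z sX sY; have := D23 Y X Z sY sX sZ.
    have := D12 Y Z X sY sZ; have := D23 Z Y X sZ sY sX.
    have := D12 Z X Y sZ sX; have := D23 X Z Y sX sZ sY; lra.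
  by rewrite /D; lra.
apply/funext => p; have [h00 h11 h01] := fr p.
have ex := orthogonal_expansion (hC p) (hL p) h00 h11 h01 (oner_neq0 _).
rewrite (ex (nabla A Gamma X Y p)) (ex (nabla A Gamma' X Y p)).
by have := key _ p s0; have := key _ p s1; rewrite /inner => -> ->.
Qed.

(** The term along the bracket depends on the value of the bracket at each
point, which is expanded in the frame to reach derivatives along smooth
fields. *)
Lemma riemann_unique h Gamma Gamma' E0 E1 X Y Z :
  diff_metric h -> levi_civita A h Gamma -> levi_civita A h Gamma' ->
  smooth_field A E0 -> smooth_field A E1 -> orthonormal_frame h E0 E1 ->
  smooth_field A X -> smooth_field A Y -> smooth_field A Z ->
  riemann A Gamma X Y Z = riemann A Gamma' X Y Z.
Proof.
move=> hm LC LC' s0 s1 fr sX sY sZ; case: (hm) => hC hL _.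
have [aff _ _] := LC; have [aff' _ _] := LC'.
have U B C (sB : smooth_field A B) (sC : smooth_field A C) :
    nabla A Gamma B C = nabla A Gamma' B C.
  exact: (levi_civita_unique hm LC LC' s0 s1 fr sB sC).
have UU B C D (sB : smooth_field A B) (sC : smooth_field A C)
    (sD : smooth_field A D) :
    nabla A Gamma B (nabla A Gamma C D) = nabla A Gamma' B (nabla A Gamma' C D).
  by rewrite (U _ _ sB (smooth_nabla LC sC sD)) (U _ _ sC sD).
apply/funext => p; rewrite /riemann (UU _ _ _ sX sY sZ) (UU _ _ _ sY sX sZ).
congr (_ - _); have [h00 h11 h01] := fr p.
have brE := orthogonal_expansion (hC p) (hL p) h00 h11 h01 (oner_neq0 _)
  (bracket A X Y p).
rewrite (nabla_comb hA aff sZ brE) (nabla_comb hA aff' sZ brE).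
by rewrite (U _ _ s0 sZ) (U _ _ s1 sZ).
Qed.

End Metric.

(** * The metric induced by a section of the tangent bundle *)

Section Induced.
Context {R : realType} {V : normedModType R} {M : topologicalType}.
Variable A : charted V M.
Hypothesis hA : smooth_manifold A.

(** The first component is the velocity of the base point because the chart maps
are inverse to each other near the base point. *)
Lemma differential_section X p u : smooth_field A X ->
  differential A (tangent_bundle A) (section_of X) p u =
  (u, dfield A (fun=> u) X p).
Proof.
move=> sX; rewrite /differential.
set c := chart_at A p.
have -> : 'D_u (cmap (chart_at (tangent_bundle A) (section_of X p)) \o
            section_of X \o cinv c) (cmap c p) =
          'D_u (fun x : V => (x, field_in A c X x)) (cmap c p).
  apply: near_eq_derive; have := cinv_chart_atK_near hA p; rewrite -/c.
  by apply: filterS => x xE; rewrite /= -/c xE.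
have dX : differentiable (field_in A c X) (cmap c p) by exact: field_in_diff.
have did : differentiable (id : V -> V) (cmap c p) by [].
rewrite deriveE; last exact: differentiable_pair did dX.
have idE : 'd (id : V -> V) (cmap c p) = id :> (V -> V) by exact: diff_val.
rewrite (diff_pair did dX) /dfield -/c (deriveE _ dX) /=.
by congr pair; exact: (congr1 (fun f : V -> V => f u) idE).
Qed.

(** As [nabla] depends on its direction through the value at [p] only, any
extension of [a] and [b] will do; here it has constant components. Hence
[inner (section_metric g Gamma xi) X Y] unfolds to
[g(X,Y) + g(nabla_X xi, nabla_Y xi)]. *)
Definition section_metric (g : M -> V -> V -> R) (Gamma : M -> V -> V -> V)
    (xi : M -> V) (p : M) (a b : V) : R :=
  g p a b + g p (nabla A Gamma (fun=> a) xi p) (nabla A Gamma (fun=> b) xi p).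

(** The differential of [xi] sends [a] to [a^h + (nabla_a xi)^v]. *)
Lemma sasaki_induced_metric g Gamma xi : smooth_field A xi ->
  induced_metric A (tangent_bundle A) (section_of xi) (sasaki g Gamma) =
  section_metric g Gamma xi.
Proof.
move=> sxi; apply/funext => p; apply/funext => a; apply/funext => b.
by rewrite /induced_metric !differential_section.
Qed.

End Induced.

Lemma section_metric_diff (R : realType) (M : topologicalType)
    (A : charted 'rV[R]_2 M) (hA : smooth_manifold A) g Gamma xi :
  diff_metric A g -> levi_civita A g Gamma -> smooth_field A xi ->
  diff_metric A (section_metric A g Gamma xi).
Proof.
move=> [gC gL gd] LC sxi; have [aff _ _] := LC.
split=> [q a b|q t a b c|X Y sX sY].
- by rewrite /section_metric gC; congr (_ + _); exact: gC.
- have E : (fun=> t *: a + b : 'rV[R]_2) q =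
      t *: (fun=> a : 'rV[R]_2) q + 1 *: (fun=> b : 'rV[R]_2) q.
    by rewrite scale1r.
  by rewrite /section_metric gL (nabla_comb hA aff sxi E) scale1r gL; ring.
- apply: (diff_funD (gd _ _ sX sY)).
  exact: (gd _ _ (smooth_nabla LC sX sxi) (smooth_nabla LC sY sxi)).
Qed.

(** * Transition between two orthonormal frames *)

Section TwoFrames.
Context {R : realType} {M : topologicalType}.
Variable A : charted 'rV[R]_2 M.
Hypothesis hA : smooth_manifold A.
Variables (g : M -> 'rV[R]_2 -> 'rV[R]_2 -> R)
  (Gamma : M -> 'rV[R]_2 -> 'rV[R]_2 -> 'rV[R]_2).
Hypothesis gm : diff_metric A g.
Hypothesis gLC : levi_civita A g Gamma.
Variables u v e0 e1 : M -> 'rV[R]_2.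
Hypotheses (su : smooth_field A u) (sv : smooth_field A v).
Hypotheses (s0 : smooth_field A e0) (s1 : smooth_field A e1).
Hypotheses (fuv : orthonormal_frame g u v) (fe : orthonormal_frame g e0 e1).
Local Notation N := (nabla A Gamma).

Definition transition_det (p : M) : R :=
  inner g u e0 p * inner g v e1 p - inner g u e1 p * inner g v e0 p.

Lemma frame_parseval a b X Y p : orthonormal_frame g a b ->
  inner g X Y p = inner g X a p * inner g Y a p + inner g X b p * inner g Y b p.
Proof.
case/(_ p) => aa bb ab; case: gm => gC gL _.
have := orthogonal_parseval (gC p) (gL p) aa bb ab (oner_neq0 _) (X p) (Y p).
by rewrite divr1.
Qed.

Lemma nabla_frame a b X p : smooth_field A a -> smooth_field A b ->
  orthonormal_frame g a b -> smooth_field A X ->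
  [/\ inner g (N X a) a p = 0, inner g (N X b) b p = 0 &
      inner g (N X b) a p = - inner g (N X a) b p].
Proof.
move=> sa sb fab sX.
have faa q : inner g a a q = 1 by case: (fab q).
have fbb q : inner g b b q = 1 by case: (fab q).
have fo q : inner g a b q = 0 by case: (fab q).
split.
- exact: (nabla_unit gm gLC sa faa p sX).
- exact: (nabla_unit gm gLC sb fbb p sX).
- exact: (nabla_orthogonal gm gLC sa sb fo p sX).
Qed.

Lemma transition_det_sqr p : transition_det p ^+ 2 = 1.
Proof.
have [uu vv uv] := fuv p.
apply: orthonormal_det_sqr.
- by rewrite !expr2 -(frame_parseval u u p fe).
- by rewrite !expr2 -(frame_parseval v v p fe).
- by rewrite -(frame_parseval u v p fe).
Qed.

(** Both frames rotate: [l] and [w] are the rotation rates of [(u,v)] and of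
[(e0,e1)] along [X]. *)
Lemma dfun_transition X p : smooth_field A X ->
  let l := inner g (N X u) v p in
  let w := inner g (N X e0) e1 p in
  [/\ dfun A X (inner g u e0) p = l * inner g v e0 p + w * inner g u e1 p,
      dfun A X (inner g u e1) p = l * inner g v e1 p - w * inner g u e0 p,
      dfun A X (inner g v e0) p = - l * inner g u e0 p + w * inner g v e1 p &
      dfun A X (inner g v e1) p = - l * inner g u e1 p - w * inner g v e0 p].
Proof.
move=> sX l w; have [_ _ compat] := gLC.
have [Nuu Nvv Nvu] := nabla_frame p su sv fuv sX.
have [N00 N11 N10] := nabla_frame p s0 s1 fe sX.
split; rewrite compat//.
- rewrite (frame_parseval (N X u) _ p fuv) (frame_parseval _ (N X e0) p fe).
  by rewrite Nuu N00 -/l -/w (innerC gm e0 v); ring.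
- rewrite (frame_parseval (N X u) _ p fuv) (frame_parseval _ (N X e1) p fe).
  by rewrite Nuu N11 N10 -/l -/w (innerC gm e1 v); ring.
- rewrite (frame_parseval (N X v) _ p fuv) (frame_parseval _ (N X e0) p fe).
  by rewrite Nvv Nvu N00 -/l -/w (innerC gm e0 u); ring.
- rewrite (frame_parseval (N X v) _ p fuv) (frame_parseval _ (N X e1) p fe).
  by rewrite Nvv Nvu N11 N10 -/l -/w (innerC gm e1 u); ring.
Qed.

Lemma diff_inner X Y : smooth_field A X -> smooth_field A Y ->
  diff_fun A (inner g X Y).
Proof. by case: gm => _ _; apply. Qed.

(** Differentiability of [X(g(Y,Z))] needs no second derivative of [g(Y,Z)]:
compatibility rewrites it with inner products of smooth fields. *)
Lemma diff_dfun_inner X Y Z :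
  smooth_field A X -> smooth_field A Y -> smooth_field A Z ->
  diff_fun A (dfun A X (inner g Y Z)).
Proof.
move=> sX sY sZ.
have -> : dfun A X (inner g Y Z) =
    fun q => inner g (N X Y) Z q + inner g Y (N X Z) q.
  by apply/funext => q; have [_ _ compat] := gLC; rewrite compat.
apply: diff_funD.
  exact: (diff_inner (smooth_nabla gLC sX sY) sZ).
exact: (diff_inner sY (smooth_nabla gLC sX sZ)).
Qed.

Lemma diff_transition_det : diff_fun A transition_det.
Proof.
apply: diff_funD.
  exact: (diff_funM (diff_inner su s0) (diff_inner sv s1)).
exact: (diff_funN (diff_funM (diff_inner su s1) (diff_inner sv s0))).
Qed.

(** The transition matrix moves by rotations on both sides, which leave the
determinant unchanged. *)
Lemma dfun_transition_det X p : smooth_field A X ->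
  dfun A X transition_det p = 0.
Proof.
move=> sX; have [du0 du1 dv0 dv1] := dfun_transition p sX.
have d00 := diff_inner su s0; have d01 := diff_inner su s1.
have d10 := diff_inner sv s0; have d11 := diff_inner sv s1.
rewrite /transition_det (dfunD _ _ (diff_funM d00 d11)); last first.
  exact: (diff_funN (diff_funM d01 d10)).
rewrite (dfunN _ _ (diff_funM d01 d10)) (dfunM hA _ _ d00 d11).
by rewrite (dfunM hA _ _ d01 d10) du0 du1 dv0 dv1; ring.
Qed.

(** The determinant of [(u,v)] in the chart is [transition_det] times that of
[(e0,e1)], so the product that [same_orientation] tests has the sign of
[transition_det]. *)
Lemma transition_det_sign p :
  transition_det p =
  (-1) ^+ (if same_orientation u v e0 e1 p then 1 else 0)%N.+1.
Proof.
case: (gm) => gC gL _.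
have [h00 h11 h01] := fe p.
have ex := orthogonal_expansion (gC p) (gL p) h00 h11 h01 (oner_neq0 _).
have detE : \det (col_mx (u p) (v p) : 'M[R]_2) =
    transition_det p * \det (col_mx (e0 p) (e1 p) : 'M[R]_2).
  rewrite !det_col_mx {1 2}(ex (u p)) {1 2}(ex (v p)) !mxE /transition_det.
  by rewrite /inner !divr1; ring.
have det0 : \det (col_mx (e0 p) (e1 p) : 'M[R]_2) != 0.
  have := orthogonal_row_free (gC p) (gL p) h00 h11 h01 (oner_neq0 _).
  by rewrite row_free_unit unitmxE unitfE.
rewrite /same_orientation detE -mulrA -expr2 pmulr_lgt0; last first.
  by rewrite lt_neqAle sqr_ge0 andbT eq_sym expf_neq0.
have /eqP := transition_det_sqr p; rewrite sqrf_eq1 => /orP[]/eqP->.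
  by rewrite ltr01 expr2 mulrNN mulr1.
by rewrite ltr0N1 expr1.
Qed.

Variable lambda : M -> R.
Hypothesis parallel : forall p, N e0 u p = 0.
Hypothesis rotation : forall p, N e1 u p = lambda p *: v p.

Lemma rotationE : inner g (N e1 u) v = lambda.
Proof.
apply/funext => p; case: (gm) => gC gL _; have [_ vv _] := fuv p.
by rewrite /inner rotation (metricZl (gL p)) -/(inner g v v p) vv mulr1.
Qed.

(** The structure equation of the frame [(u,v)], whose connection coefficients
are [lambda g(u,e1)] and [lambda g(v,e1)]: the derivatives of [g(u,e1)] and
[g(v,e1)] contribute the term [g(nabla_{e1}e0, e1) lambda] and another that
cancels the squares of the coefficients. *)
Lemma curvature_rotation p :
  inner g (riemann A Gamma u v v) u p = - transition_det p *
    (dfun A e0 lambda p + inner g (N e1 e0) e1 p * lambda p).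
Proof.
case: (gm) => gC gL _; have [aff _ _] := gLC.
have [h00 h11 h01] := fe p.
have uu q : inner g u u q = 1 by case: (fuv q).
have uv q : inner g u v q = 0 by case: (fuv q).
have vv : inner g v v = fun=> 1 by apply/funext => q; case: (fuv q).
have frameE X q : X q = inner g X e0 q *: e0 q + inner g X e1 q *: e1 q.
  have [k00 k11 k01] := fe q.
  have := orthogonal_expansion (gC q) (gL q) k00 k11 k01 (oner_neq0 _) (X q).
  by rewrite divr1.
have rotE X : inner g (N X u) v = fun q => inner g X e1 q * lambda q.
  apply/funext => q; rewrite /inner (nabla_comb hA aff su (frameE X q)).
  rewrite parallel scaler0 add0r rotation scalerA (metricZl (gL q)).
  by rewrite -/(inner g v v q) vv mulr1.
have dl : diff_fun A lambda.
  by rewrite -rotationE; exact: (diff_inner (smooth_nabla gLC s1 su) sv).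
have d1 := diff_inner su s1; have d2 := diff_inner sv s1.
have l0 : inner g (N e0 u) v p = 0.
  by rewrite /inner parallel (metric0l (gL p)).
have [_ du0 _ dv0] := dfun_transition p s0.
have [_ du1 _ dv1] := dfun_transition p s1.
rewrite (frame_curvature hA gm gLC su sv uu uv); last by rewrite vv oner_neq0.
rewrite (rotE u) (rotE v) vv !dfun_cst.
rewrite (dfun_comb (diff_funM d1 dl) (frameE v p)).
rewrite (dfun_comb (diff_funM d2 dl) (frameE u p)).
rewrite !(dfunM hA _ _ d1 dl) !(dfunM hA _ _ d2 dl).
rewrite du0 dv0 du1 dv1 l0 rotationE /transition_det.
(* The derivatives of lambda along e1 cancel: only the minor of the transition
   matrix that multiplies e0(lambda) survives. *)
move: (inner g u e0 p) (inner g u e1 p) (inner g v e0 p) (inner g v e1 p).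
move: (inner g (N e0 e0) e1 p) (inner g (N e1 e0) e1 p).
move: (dfun A e0 lambda p) (dfun A e1 lambda p) (lambda p).
by move=> *; field.
Qed.

Lemma dfun_norm2 X p : dfun A X (fun q => 1 + lambda q ^+ 2) p =
  2 * lambda p * dfun A X lambda p.
Proof.
have dl : diff_fun A lambda.
  by rewrite -rotationE; exact: (diff_inner (smooth_nabla gLC s1 su) sv).
have -> : (fun q => 1 + lambda q ^+ 2) = (fun q => 1 + lambda q * lambda q).
  by apply/funext => q; rewrite expr2.
rewrite (dfunD _ _ (diff_fun_cst A 1) (diff_funM dl dl)) dfun_cst.
by rewrite (dfunM hA _ _ dl dl); ring.
Qed.

Local Notation h := (section_metric A g Gamma u).

Lemma inner_section_metric X Y p :
  inner h X Y p = inner g X Y p + inner g (N X u) (N Y u) p.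
Proof. by []. Qed.

Lemma section_metric_parallel X p : inner h X e0 p = inner g X e0 p.
Proof.
case: (gm) => gC gL _; rewrite (inner_section_metric X e0).
by rewrite [inner g _ (N e0 u) p]/inner parallel gC (metric0l (gL p)) addr0.
Qed.

Lemma section_metric_frame p :
  [/\ inner h e0 e0 p = 1, inner h e0 e1 p = 0 &
      inner h e1 e1 p = 1 + lambda p ^+ 2].
Proof.
have hm := section_metric_diff hA gm gLC su.
case: (gm) => gC gL _; have [h00 h11 h01] := fe p; have [_ vv _] := fuv p.
split; first by rewrite section_metric_parallel.
  by rewrite (innerC hm e0) section_metric_parallel (innerC gm e1).
rewrite (inner_section_metric e1 e1) h11 /inner rotation.
rewrite (metricZl (gL p)) gC (metricZl (gL p)).
by rewrite -/(inner g v v p) vv mulr1 -expr2.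
Qed.

(** By [section_metric_frame], [h(R(e0,e1)e1,e0)] is [1 + lambda^2] times the
Gaussian curvature of [h]. The two hypotheses on [K] are the curvature of [g]
read in each of its frames; they eliminate [sigma = g(nabla_{e1}e0, e1)] and
[e0(sigma)]. *)
Lemma curvature_section_metric Gamma' mu K p :
  levi_civita A h Gamma' ->
  (forall q, N e0 e0 q = mu q *: e1 q) ->
  (forall q, inner g (riemann A Gamma e0 e1 e1) e0 q = K q) ->
  (forall q, inner g (riemann A Gamma u v v) u q = K q) ->
  inner h (riemann A Gamma' e0 e1 e1) e0 p =
    K p * (1 - K p)
    + transition_det p *
      (lambda p * dfun A e0 K p - K p * dfun A e0 lambda p)
    - (dfun A e0 lambda p ^+ 2 + mu p * lambda p * dfun A e1 lambda p)
      / (1 + lambda p ^+ 2).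
Proof.
move=> LC' hmu Ke Kuv; have hm := section_metric_diff hA gm gLC su.
case: (gm) => gC gL _; have [aff _ _] := gLC.
have e00 q : inner g e0 e0 q = 1 by case: (fe q).
have e11 q : inner g e1 e1 q = 1 by case: (fe q).
have e11F : inner g e1 e1 = fun=> 1 by apply/funext.
have e01 q : inner g e0 e1 q = 0 by case: (fe q).
have vv q : inner g v v q = 1 by case: (fuv q).
pose sg := inner g (N e1 e0) e1.
pose F q := 1 + lambda q ^+ 2.
have F0 q : F q != 0 by rewrite /F gt_eqF// ltr_pwDl// sqr_ge0.
have s1u := smooth_nabla gLC s1 su.
have dl : diff_fun A lambda by rewrite -rotationE; exact: (diff_inner s1u sv).
have dl0 : diff_fun A (dfun A e0 lambda).
  by rewrite -rotationE; exact: (diff_dfun_inner s0 s1u sv).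
have dsg : diff_fun A sg := diff_inner (smooth_nabla gLC s1 s0) s1.
have dep := diff_transition_det.
have KE q : K q = - transition_det q * (dfun A e0 lambda q + sg q * lambda q).
  by rewrite -Kuv curvature_rotation.
have dK : diff_fun A K.
  rewrite (_ : K = fun q =>
    - transition_det q * (dfun A e0 lambda q + sg q * lambda q)); last first.
    exact/funext.
  exact: (diff_funM (diff_funN dep) (diff_funD dl0 (diff_funM dsg dl))).
have muE : inner g (N e0 e0) e1 = mu.
  apply/funext => q; rewrite /inner hmu (metricZl (gL q)).
  by rewrite -/(inner g e1 e1 q) e11 mulr1.
have h00 q : inner h e0 e0 q = 1 by case: (section_metric_frame q).
have h01 q : inner h e0 e1 q = 0 by case: (section_metric_frame q).
have h11 : inner h e1 e1 = F.
  by apply/funext => q; case: (section_metric_frame q).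
have br0 q : inner g (bracket A e0 e1) e0 q = - mu q.
  by rewrite -muE (koszul_E0 gm gLC s0 s1 e00 e01) opprK.
have br1 q : inner g (bracket A e0 e1) e1 q = - sg q.
  by rewrite /sg (koszul_E1 gm gLC s0 s1) e11F dfun_cst; ring.
have brE q : bracket A e0 e1 q = (- mu q) *: e0 q + (- sg q) *: e1 q.
  rewrite -br0 -br1.
  have := orthogonal_expansion (gC q) (gL q) (e00 q) (e11 q) (e01 q)
    (oner_neq0 _) (bracket A e0 e1 q).
  by rewrite divr1.
have a'E : inner h (nabla A Gamma' e0 e0) e1 = mu.
  apply/funext => q; rewrite (koszul_E0 hm LC' s0 s1 h00 h01).
  by rewrite section_metric_parallel br0 opprK.
(* The value lambda e0(lambda) + sigma F, simplified by KE. *)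
have c'E : inner h (nabla A Gamma' e1 e0) e1 =
    fun q => sg q - transition_det q * (lambda q * K q).
  apply/funext => q; rewrite (koszul_E1 hm LC' s0 s1) h11 dfun_norm2.
  rewrite (inner_section_metric (bracket A e0 e1) e1) br1.
  rewrite [inner g _ (N e1 u) q]/inner (nabla_comb hA aff su (brE q)).
  rewrite parallel scaler0 add0r rotation scalerA (metricZl (gL q)).
  rewrite gC (metricZl (gL q)) -/(inner g v v q) vv KE.
  have := transition_det_sqr q.
  move: (transition_det q) (sg q) (lambda q) (dfun A e0 lambda q).
  move=> t x l l0 t2.
  have -> : x - t * (l * (- t * (l0 + x * l))) =
      x + t ^+ 2 * (l * (l0 + x * l)).
    by ring.
  by rewrite t2; field.
have /= := frame_curvature hA hm LC' s0 s1 h00 h01 (p := p).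
rewrite a'E c'E h11 => /(_ (F0 p)) ->.
have /= := frame_curvature hA gm gLC s0 s1 e00 e01 (p := p).
rewrite muE e11F Ke !dfun_cst => /(_ (oner_neq0 _)).
rewrite -/sg.
rewrite (dfunD _ _ dsg (diff_funN (diff_funM dep (diff_funM dl dK)))).
rewrite (dfunN _ _ (diff_funM dep (diff_funM dl dK))).
rewrite (dfunM hA _ _ dep (diff_funM dl dK)) (dfunM hA _ _ dl dK).
rewrite (dfun_transition_det p s0) !dfun_norm2.
have := F0 p; rewrite /F.
have := KE p; have := transition_det_sqr p.
move: (transition_det p) (sg p) (lambda p) (K p) (mu p).
move: (dfun A e0 lambda p) (dfun A e1 lambda p) (dfun A e0 sg p).
move: (dfun A e0 K p) (dfun A e1 mu p).
move=> k0 m1 l0 l1 g0 t x l k m t2 kE Fn0 curv.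
(* With w = t K one has e0(lambda) = - w - sigma lambda and K^2 = w^2, which
   keeps the relation t^2 = 1 out of the rational identity to be checked. *)
have [w wE] : exists w, w = t * k by eexists.
have kkE : k * (1 - k) = k - w ^+ 2 by rewrite wE exprMn t2; ring.
have l0E : l0 = - w - x * l.
  have -> : w = - (t ^+ 2 * (l0 + x * l)) by rewrite wE kE; ring.
  by rewrite t2; ring.
have m1E : m1 = k + g0 + m ^+ 2 + x ^+ 2 by rewrite curv; field.
have -> : t * (l * k0 + k * l0) = t * l * k0 + w * l0 by rewrite wE; ring.
have -> : t * (l * k0 - k * l0) = t * l * k0 - w * l0 by rewrite wE; ring.
have -> : t * (l * k) = l * w by rewrite wE; ring.
by rewrite kkE m1E l0E; field.
Qed.

End TwoFrames.

(** * The Gaussian curvature of a unit vector field *)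

Theorem lemma3p4 (R : realType) (M : topologicalType)
  (A : charted 'rV[R]_2 M) (hA : smooth_manifold A)
  (g : M -> 'rV[R]_2 -> 'rV[R]_2 -> R) (hg : riemannian_metric A g)
  (Gamma : M -> 'rV[R]_2 -> 'rV[R]_2 -> 'rV[R]_2)
  (hGamma : levi_civita A g Gamma)
  (K : M -> R) (hK : gaussian_curvature A g K)
  (xi eta e0 e1 : M -> 'rV[R]_2)
  (hxi : smooth_field A xi) (heta : smooth_field A eta)
  (he0 : smooth_field A e0) (he1 : smooth_field A e1)
  (hxi_unit : forall p, inner g xi xi p = 1)
  (hframe : orthonormal_frame g xi eta)
  (hframe' : orthonormal_frame g e0 e1)
  (hparallel : forall p, nabla A Gamma e0 xi p = 0)
  (lambda mu : M -> R)
  (hlambda : forall p, nabla A Gamma e1 xi p = lambda p *: eta p)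
  (hmu : forall p, nabla A Gamma e0 e0 p = mu p *: e1 p)
  (K_xi : unit_tangent_bundle g -> R)
  (hK_xi : image_gaussian_curvature A (tangent_bundle A)
             (unit_section hxi_unit) (sasaki g Gamma) K_xi)
  (p : M) :
  let s : nat := if same_orientation xi eta e0 e1 p then 1%N else 0%N in
  K_xi (unit_section hxi_unit p) =
    K p ^+ 2 / 4 + K p * (1 - K p) / (1 + lambda p ^+ 2)
    + (-1) ^+ s.+1 * (lambda p / (1 + lambda p ^+ 2)) * dfun A e0 K p
    + 1 / 2 * mu p * dfun A e1 (fun q => 1 / (1 + lambda q ^+ 2)) p
    - ((-1) ^+ s.+1 * (K p / 2)
       + dfun A e0 lambda p / (1 + lambda p ^+ 2)) ^+ 2.
Proof.
have gm := riemannian_diff_metric hA hg.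
(* K is given through some Levi-Civita connection, whose curvature agrees with
   that of Gamma by uniqueness. *)
have curvE X Y q : smooth_field A X -> smooth_field A Y ->
    orthonormal_frame g X Y -> inner g (riemann A Gamma X Y Y) X q = K q.
  move=> sX sY /(_ q)[XX YY XY]; have [Gamma2 LC2 KE] := hK.
  rewrite (riemann_unique hA gm hGamma LC2 he0 he1 hframe' sX sY sY).
  by rewrite KE// XX YY XY expr0n /= subr0 !mulr1.
have indE : induced_metric A (tangent_bundle A)
    (fun q => val (unit_section hxi_unit q)) (sasaki g Gamma) =
  section_metric A g Gamma xi := sasaki_induced_metric hA g Gamma hxi.
move: hK_xi; rewrite /image_gaussian_curvature indE => -[Gamma' LC' KxiE].
have := KxiE _ _ he0 he1 p.
rewrite (curvature_section_metric hA gm hGamma hxi heta he0 he1 hframe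
  hframe' hparallel hlambda p LC' hmu
  (fun q => curvE _ _ q he0 he1 hframe')
  (fun q => curvE _ _ q hxi heta hframe)).
have [-> -> ->] := section_metric_frame hA gm hGamma hxi hframe hframe'
  hparallel hlambda p.
rewrite -[(K_xi \o _) p]/(K_xi (unit_section hxi_unit p)) => Kh.
have F0 q : 1 + lambda q ^+ 2 != 0 by rewrite gt_eqF// ltr_pwDl// sqr_ge0.
have t2 := transition_det_sqr gm hframe hframe' p.
rewrite -(transition_det_sign gm hframe hframe' p).
have -> : dfun A e1 (fun q => 1 / (1 + lambda q ^+ 2)) p =
    - (2 * lambda p * dfun A e1 lambda p) / (1 + lambda p ^+ 2) ^+ 2.
  have E : (fun q => 1 / (1 + lambda q ^+ 2)) =
      (fun q => (1 + lambda q ^+ 2)^-1) by apply/funext => q; rewrite div1r.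
  have dF : diff_fun A (fun q => 1 + lambda q ^+ 2).
    have -> : (fun q => 1 + lambda q ^+ 2) =
        inner (section_metric A g Gamma xi) e1 e1.
      apply/funext => q; have [_ _ //] := section_metric_frame hA gm hGamma
        hxi hframe hframe' hparallel hlambda q.
    have [_ _ hd] := section_metric_diff hA gm hGamma hxi.
    exact: (hd _ _ he1 he1).
  rewrite E (dfunV hA _ dF (F0 p)).
  by rewrite (dfun_norm2 hA gm hGamma hxi heta he1 hframe hlambda).
have {Kh} Kh : K_xi (unit_section hxi_unit p) * (1 + lambda p ^+ 2) =
    K p * (1 - K p) + transition_det g xi eta e0 e1 p *
      (lambda p * dfun A e0 K p - K p * dfun A e0 lambda p)
    - (dfun A e0 lambda p ^+ 2 + mu p * lambda p * dfun A e1 lambda p)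
      / (1 + lambda p ^+ 2).
  by rewrite Kh; ring.
apply: (mulIf (F0 p)); rewrite {}Kh.
have := F0 p; move: t2.
move: (transition_det g xi eta e0 e1 p) (lambda p) (mu p) (K p).
move: (dfun A e0 lambda p) (dfun A e1 lambda p) (dfun A e0 K p).
move=> l0 l1 k0 t l m k t2 Fp0.
have -> : (t * (k / 2) + l0 / (1 + l ^+ 2)) ^+ 2 =
    k ^+ 2 / 4 + t * k * l0 / (1 + l ^+ 2) + l0 ^+ 2 / (1 + l ^+ 2) ^+ 2.
  have -> : k ^+ 2 / 4 = t ^+ 2 * (k ^+ 2 / 4) by rewrite t2 mul1r.
  by field.
by field.
Qed.
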